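(* There exists a dense $G_{\delta}$ set $G\subset\mathbb{R}$ with $m(\mathbb{R}\setminus G)=0$ such that for all Cantor sets $J\subset\mathbb{R}$ with positive Newhouse thickness, $G$ does not contain an affine copy of $J$. As a consequence, Cantor sets on $\mathbb{R}^1$ with positive Newhouse thickness are not generically universal.
   Context: $m$ denotes Lebesgue measure. A Cantor set in $\mathbb{R}$ is a nonempty, totally disconnected, perfect and compact subset of $\mathbb{R}$. An affine copy of $J\subset\mathbb{R}$ is a set $t+\lambda J$ with $t\in\mathbb{R}$ and $\lambda\neq 0$. A set $E\subset\mathbb{R}$ is generically universal if every dense $G_\delta$ set $G\subset\mathbb{R}$ with $m(\mathbb{R}\setminus G)=0$ contains an affine copy of $E$. Newhouse thickness. Let $K\subset\mathbb{R}$ be a Cantor set. A gap of $K$ is a connected component of $\mathbb{R}\setminus K$; a bounded gap is a bounded connected component of $\mathbb{R}\setminus K$. $|I|$ denotes the length of an interval $I$ (unbounded gaps have infinite length). Let $U=(u',u)$ be a bounded gap of $K$. The bridge $C$ of $K$ at $u$ is the maximal interval on the right hand side of $u$ such that $u$ is a boundary point of $C$ and $C$ contains no point of a gap $U'$ with $|U'|\ge |U|$. The bridge at $u'$ is defined analogously, as the maximal interval on the left hand side of $u'$ with the same property. For a boundary point $u$ of a bounded gap $U$ with bridge $C$ at $u$, the thickness of $K$ at $u$ is $\tau(K,u)=|C|/|U|$. The Newhouse thickness of $K$ is $\tau(K)=\inf_{u\in\mathcal{U}}\tau(K,u)$, where $\mathcal{U}$ is the set of all boundary points of bounded gaps of $K$.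 *)

(* Defs.v *)
From HB Require Import structures.
From mathcomp Require Import all_boot all_order all_algebra.
From mathcomp Require Import all_classical all_reals all_analysis.
From mathcomp Require Import borel_hierarchy.
Import Order.TTheory GRing.Theory Num.Theory.
Import numFieldNormedType.Exports.

Set Implicit Arguments.
Unset Strict Implicit.
Unset Printing Implicit Defensive.

Local Open Scope classical_set_scope.
Local Open Scope ring_scope.

Definition cantor_subset {R : realType} (K : set R) : Prop :=
  [/\ K !=set0, totally_disconnected K, perfect_set K & compact K].

Definition affine_image {R : realType} (t l : R) (E : set R) : set R :=
  [set t + l * x | x in E].

Definition contains_affine_copy {R : realType} (G E : set R) : Prop :=
  exists t l : R, l != 0 /\ affine_image t l E `<=` G.

Definition generically_universal {R : realType} (E : set R) : Prop :=
  forall G : set R, dense G -> Gdelta G -> lebesgue_measure (~` G) = 0%E ->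
    contains_affine_copy G E.

(* Only applied to intervals; unbounded intervals get +oo. *)
Definition interval_length {R : realType} (I : set R) : \bar R :=
  lebesgue_measure I.

Definition boundary {R : realType} (A : set R) : set R :=
  closure A `\` A^°.

Definition gap {R : realType} (K U : set R) : Prop :=
  exists2 x, (~` K) x & U = connected_component (~` K) x.

(* [gap K U'] includes the two unbounded gaps, so bridges are bounded. *)
Definition bridge_candidate {R : realType}
    (K U side : set R) (u : R) (C : set R) : Prop :=
  [/\ is_interval C, C `<=` side, boundary C u &
      forall U', gap K U' -> (interval_length U <= interval_length U')%E ->
        C `&` U' = set0].

Definition bridge {R : realType}
    (K U side : set R) (u : R) (C : set R) : Prop :=
  bridge_candidate K U side u C /\
  forall C', bridge_candidate K U side u C' -> C `<=` C' -> C' = C.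

Definition right_bridge {R : realType} (K U : set R) (u : R) : set R -> Prop :=
  bridge K U `[u, +oo[ u.

Definition left_bridge {R : realType} (K U : set R) (u : R) : set R -> Prop :=
  bridge K U `]-oo, u] u.

(* [thickness_at K u r] is the graph of the function tau(K, u) = r, defined at
   the boundary points u of the bounded gaps ]a, b[ of K. *)
Definition thickness_at {R : realType} (K : set R) (u : R) (r : \bar R) : Prop :=
  exists a b : R, exists C : set R,
    [/\ gap K `]a, b[,
        (u = b /\ right_bridge K `]a, b[ u C) \/
        (u = a /\ left_bridge K `]a, b[ u C) &
        r = (interval_length C / interval_length `]a, b[)%E].

Definition newhouse_thickness {R : realType} (K : set R) : \bar R :=
  ereal_inf [set r | exists u : R, thickness_at K u r].

(* Main.v *)
Require Import Defs.
From HB Require Import structures.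
From mathcomp Require Import all_boot all_order all_algebra.
From mathcomp Require Import all_classical all_reals all_analysis.
From mathcomp Require Import borel_hierarchy.
From mathcomp Require Import lra ring.
Import Order.TTheory GRing.Theory Num.Theory.
Import numFieldNormedType.Exports.

Set Implicit Arguments.
Unset Strict Implicit.
Unset Printing Implicit Defensive.

(** The set G is the complement of a countable union of closed null sets: the
    central Cantor sets C(n, q) living on the ball of radius e_n = 1/(n+2)
    around a rational q, each of whose stages removes from every remaining
    ball the concentric open ball with radius the fraction e_n of the old one.
    The union is null because each stage multiplies the measure by 1 - e_n.

    What has to be seen is that an affine copy A of a thick Cantor set J meets
    one of the C(n, q).  Thickness enters only through the following consequence
    (no_isolated_cluster): if some points of A lie in a small ball of radius h
    and A avoids the annulus of width s around it, with h much smaller than s,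
    then all of A lies in that ball.  Otherwise the extreme points m <= M of
    the cluster are endpoints of gaps of length greater than s; the shorter of
    these two gaps is bounded, and its bridge on the side of the cluster is
    exactly [m, M], because the gap at the other end of the cluster is at least
    as long.  The thickness there is at most 2h / s, which is too small.  This
    is thick_no_isolated_cluster.  Unlike the thickness, the property is stated
    by distances only, so it passes to affine images at once.

    Now suppose that A meets the ball B(z, l) and has diameter more than 2l.
    Removing from it the concentric ball of radius e l leaves an annulus, which
    consists of the two balls of the next stage.  If A avoided both of them,
    then A would have an isolated cluster in the removed part, hence would lie
    in the removed part, which is too short for its diameter.  So A meets a
    ball of the next stage, and the argument repeats there
    (central_stage_meets).  By compactness A meets the whole Cantor set.
    Since A only has to be large compared with the ball it meets, and since
    every point of the line lies in B(q, e_n) for some rational q however large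
    n is, the countable family suffices for all affine copies. *)

Local Open Scope classical_set_scope.
Local Open Scope ring_scope.

(** * Gaps of a subset of the line *)

Lemma interval_length_oo (R : realType) (p q : R) : p <= q ->
  interval_length `]p, q[ = (q - p)%:E.
Proof.
move=> pq; rewrite /interval_length lebesgue_measure_itv /= lte_fin.
case: ltP => [_|qp]; first by rewrite EFinB.
by have -> : q = p by [lra]; rewrite subrr.
Qed.

Lemma interval_length_cc (R : realType) (p q : R) : p <= q ->
  interval_length `[p, q] = (q - p)%:E.
Proof.
move=> pq; rewrite /interval_length lebesgue_measure_itv /= lte_fin.
case: ltP => [_|qp]; first by rewrite EFinB.
by have -> : q = p by [lra]; rewrite subrr.
Qed.

Lemma gap_is_interval (R : realType) (J U : set R) : gap J U -> is_interval U.
Proof.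
by case=> x _ ->; apply/connected_intervalP; exact: component_connected.
Qed.

Lemma gap_subC (R : realType) (J U : set R) : gap J U -> U `<=` ~` J.
Proof. by case=> x _ ->; exact: connected_component_sub. Qed.

(** A gap that contains a point between two points of [J] is trapped between
    them, being connected. *)
Lemma gap_subitv (R : realType) (J U : set R) (m M x : R) :
  gap J U -> J m -> J M -> U x -> m <= x <= M -> U `<=` `]m, M[.
Proof.
move=> gU Jm JM Ux /andP[mx xM] y Uy.
have iU := gap_is_interval gU; have sU := gap_subC gU.
rewrite /= in_itv /=; apply/andP; split; rewrite ltNge; apply/negP => yle.
- by apply: (sU m) => //; apply: (iU y x) => //; rewrite yle.
- by apply: (sU M) => //; apply: (iU x y) => //; rewrite xM.
Qed.

Lemma sub_gap (R : realType) (J : set R) (p q x : R) :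
  p < x < q -> (forall y, p < y < q -> ~ J y) ->
  exists U, [/\ gap J U, U x & `]p, q[ `<=` U].
Proof.
move=> pxq noJ; exists (connected_component (~` J) x).
have sJ : `]p, q[ `<=` ~` J by move=> y /=; rewrite in_itv /=; exact: noJ.
split; first by exists x => //; exact: noJ.
- by apply: connected_component_refl; exact: noJ.
- apply: connected_component_max => //=.
  by apply/connected_intervalP; exact: interval_is_interval.
Qed.

Lemma gap_oo (R : realType) (J : set R) (p q : R) :
  J p -> J q -> p < q -> (forall y, p < y < q -> ~ J y) -> gap J `]p, q[.
Proof.
move=> Jp Jq pq noJ.
have mid : p < (p + q) / 2 < q by lra.
have [U [gU Ux sU]] := sub_gap mid noJ.
suff -> : `]p, q[%classic = U by [].
apply/seteqP; split=> // y; apply: (gap_subitv gU Jp Jq Ux).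
by lra.
Qed.

Lemma le_interval_length (R : realType) (A B : set R) :
  is_interval A -> is_interval B -> A `<=` B ->
  (interval_length A <= interval_length B)%E.
Proof.
move=> iA iB AB; apply: le_measure => //; rewrite inE;
  exact: measurable_realfun.is_interval_measurable.
Qed.

(** * Isolated clusters and thickness *)

(** A cluster [m, M] of [J] is itself a bridge, provided that it is shorter
    than the gap [U] and that, on each of its ends that [side] lets one cross,
    it is followed by a stretch free of [J] of length at least [|U|].
    Indeed a gap that meets the cluster lies inside it, so it is shorter than
    [U]; and an interval that extends the cluster enters a gap at least as long
    as [U].  The assumption is on a free stretch and not on a gap with two
    endpoints because the gap there may be unbounded. *)
Lemma bridge_cluster (R : realType) (J U side : set R) (u m M w : R) :
  J m -> J M -> m <= M -> M - m < w -> interval_length U = w%:E ->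
  `[m, M] `<=` side -> u = m \/ u = M ->
  (forall y, side y -> y < m -> forall x, m - w < x < m -> ~ J x) ->
  (forall y, side y -> M < y -> forall x, M < x < M + w -> ~ J x) ->
  bridge J U side u `[m, M].
Proof.
move=> Jm JM mM mMw lU sideI uE noL noR; split.
  split=> //; first exact: interval_is_interval.
    split.
      by apply: subset_closure; case: uE => -> /=; rewrite in_itv /= lexx ?mM.
    by rewrite interior_itv_bnd /= in_itv /=; case: uE => ->; rewrite ltxx ?andbF.
  move=> U' gU'; rewrite lU => lU'; apply/seteqP; split=> // x [/=].
  rewrite in_itv /= => mxM U'x.
  have sU' := gap_subitv gU' Jm JM U'x mxM.
  have := le_interval_length (gap_is_interval gU')
    (@interval_is_interval _ _) sU'.
  by rewrite interval_length_oo // => /(le_trans lU'); rewrite lee_fin => ?; lra.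
have lg p x : p < x < p + w -> (forall y, p < y < p + w -> ~ J y) ->
    exists U', [/\ gap J U', U' x & (interval_length U <= interval_length U')%E].
  move=> pxw noJ; have [U' [gU' U'x sU']] := sub_gap pxw noJ.
  exists U'; split=> //.
  have -> : interval_length U = interval_length `]p, p + w[.
    by rewrite interval_length_oo ?lU; [congr EFin; ring | lra].
  apply: le_interval_length => //; first exact: interval_is_interval.
  exact: gap_is_interval gU'.
move=> C [iC sC _ noC] IC; apply/seteqP; split=> // y Cy /=.
have Cm : C m by apply: IC; rewrite /= in_itv /= lexx.
have CM : C M by apply: IC; rewrite /= in_itv /= lexx mM.
rewrite in_itv /=; apply/andP; split; rewrite leNgt; apply/negP => yM.
- have noJ x : m - w < x < m - w + w -> ~ J x.
    by move=> ?; apply: (noL y) => //; [exact: sC|lra].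
  (* A point of [C] that also lies in the free stretch next to [m]. *)
  have xb : m - w < Num.max y (m - w / 2) < m - w + w.
    by rewrite lt_max gt_max; lra.
  have [U' [gU' U'x lU']] := lg _ _ xb noJ.
  have /seteqP[+ _] := noC _ gU' lU' => /(_ (Num.max y (m - w / 2))); apply.
  split=> //; apply: (iC y m) => //.
  by rewrite le_max ge_max lexx /=; lra.
- have noJ x : M < x < M + w -> ~ J x by apply: (noR y) => //; exact: sC.
  have xb : M < Num.min y (M + w / 2) < M + w.
    by rewrite lt_min gt_min; lra.
  have [U' [gU' U'x lU']] := lg _ _ xb noJ.
  have /seteqP[+ _] := noC _ gU' lU' => /(_ (Num.min y (M + w / 2))); apply.
  split=> //; apply: (iC M y) => //.
  by rewrite ge_min le_min lexx /=; lra.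
Qed.

Lemma EFin_div (R : realType) (x y : R) : 0 < y ->
  (x%:E / y%:E)%E = (x / y)%:E.
Proof. by move=> y0; rewrite inver gt_eqF. Qed.

Lemma thickness_at_gap_right (R : realType) (J : set R) (m M q : R) :
  J m -> J M -> J q -> m <= M -> M < q -> M - m < q - M ->
  (forall x, M < x < q -> ~ J x) ->
  (forall x, m - (q - M) < x < m -> ~ J x) ->
  thickness_at J M ((M - m) / (q - M))%:E.
Proof.
move=> Jm JM Jq mM Mq short noR noL; exists M, q, `[m, M]%classic; split.
- exact: gap_oo.
- right; split=> //; apply: (@bridge_cluster _ _ _ _ _ _ _ (q - M)) => //.
  + by rewrite interval_length_oo // ltW.
  + by move=> x /=; rewrite !in_itv /= => /andP[].
  + by right.
  + by move=> y; rewrite /= in_itv /= leNgt => /negPf ->.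
- by rewrite interval_length_cc // interval_length_oo ?EFin_div ?subr_gt0 // ltW.
Qed.

Lemma thickness_at_gap_left (R : realType) (J : set R) (p m M : R) :
  J p -> J m -> J M -> p < m -> m <= M -> M - m < m - p ->
  (forall x, p < x < m -> ~ J x) ->
  (forall x, M < x < M + (m - p) -> ~ J x) ->
  thickness_at J m ((M - m) / (m - p))%:E.
Proof.
move=> Jp Jm JM pm mM short noL noR; exists p, m, `[m, M]%classic; split.
- exact: gap_oo.
- left; split=> //; apply: (@bridge_cluster _ _ _ _ _ _ _ (m - p)) => //.
  + by rewrite interval_length_oo // ltW.
  + by move=> x /=; rewrite !in_itv /= andbT => /andP[].
  + by left.
  + by move=> y; rewrite /= in_itv /= andbT leNgt => /negPf ->.
- by rewrite interval_length_cc // interval_length_oo ?EFin_div ?subr_gt0 // ltW.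
Qed.

(** The robust form of the hypothesis of positive thickness: if [J] meets the
    ball of radius [h] around [z] and avoids the annulus of width [s] around it,
    then [J] lies in the ball.  The annulus is closed, to match the closed balls
    that form the stages of a Cantor set. *)
Definition no_isolated_cluster {R : realType} (r : R) (J : set R) : Prop :=
  forall z h s : R, 0 < s -> 2 * h <= r * s ->
    (exists2 x, J x & `|x - z| <= h) ->
    (forall x, J x -> ~~ (h <= `|x - z| <= h + s)) ->
    forall x, J x -> `|x - z| <= h.

Lemma compact_has_max (R : realType) (A : set R) : A !=set0 -> compact A ->
  exists2 c, A c & forall x, A x -> x <= c.
Proof.
move=> A0 cA.
have [|c + cmax] := @compact_EVT_max R R id A A0 cA.
  by apply: continuous_subspaceT => x; exact: cvg_id.
by rewrite inE => Ac; exists c => // x Ax; apply: cmax; rewrite inE.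
Qed.

Lemma compact_has_min (R : realType) (A : set R) : A !=set0 -> compact A ->
  exists2 c, A c & forall x, A x -> c <= x.
Proof.
move=> A0 cA.
have [|c + cmin] := @compact_EVT_min R R id A A0 cA.
  by apply: continuous_subspaceT => x; exact: cvg_id.
by rewrite inE => Ac; exists c => // x Ax; apply: cmin; rewrite inE.
Qed.

(** Let [m] and [M] be the extreme points of the cluster.  If a point of [J]
    lies outside the ball, then there is a bounded gap at [m] or at [M]; both
    gaps are longer than [s].  Take the shorter one: the cluster is its bridge,
    and the quotient of lengths is at most [2 * h / s], hence at most [r]. *)
Lemma thick_no_isolated_cluster (R : realType) (r : R) (J : set R) :
  compact J -> 0 <= r <= 1 -> (r%:E < newhouse_thickness J)%E ->
  no_isolated_cluster r J.
Proof.
move=> cJ r01 rJ z h s s0 hrs [x0 Jx0 x0h] iso.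
have isoL x : J x -> x <= z - h -> x < z - h - s.
  move=> Jx xh; have := iso _ Jx; rewrite ler0_norm ?negb_and -?ltNge; last first.
    by have := normr_ge0 (x0 - z); lra.
  by case/orP; lra.
have isoR x : J x -> z + h <= x -> z + h + s < x.
  move=> Jx xh; have := iso _ Jx; rewrite ger0_norm ?negb_and -?ltNge; last first.
    by have := normr_ge0 (x0 - z); lra.
  by case/orP; lra.
have x0b : z - h <= x0 <= z + h by move: x0h; rewrite ler_norml; lra.
have cI (a b : R) : compact (J `&` `[a, b]).
  by apply: compact_closedI => //; exact: itv_closed.
have AP x : J x -> z - h <= x <= z + h -> (J `&` `[z - h, z + h]) x.
  by move=> Jx xb; split => //=; rewrite in_itv.
have A0 : (J `&` `[z - h, z + h]) !=set0 by exists x0; exact: AP.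
have [m [Jm /=]] := compact_has_min A0 (cI _ _).
rewrite in_itv /= => mb mmin.
have [M [JM /=]] := compact_has_max A0 (cI _ _).
rewrite in_itv /= => Mb Mmax.
have mM : m <= M by apply: Mmax; exact: AP.
have mh : z - h < m by rewrite ltNge; apply/negP => /(isoL _ Jm); lra.
have Mh : M < z + h by rewrite ltNge; apply/negP => /(isoR _ JM); lra.
have Mmrs : M - m <= r * s by lra.
have rs : r * s <= s by rewrite -[leRHS]mul1r ler_wpM2r //; [exact: ltW | lra].
have thin w u : s < w -> ~ thickness_at J u ((M - m) / w)%:E.
  move=> sw tu; suff : (newhouse_thickness J <= r%:E)%E by rewrite leNgt rJ.
  apply: (@le_trans _ _ ((M - m) / w)%:E).
    by apply: ereal_inf_lbound; exists u.
  have w0 : 0 < w by lra.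
  rewrite lee_fin ler_pdivrMr // (le_trans Mmrs) // ler_wpM2l; [|by lra..].
  by case/andP: r01.
have HL : (forall x, J x -> m <= x) \/
    exists p, [/\ J p, p < z - h - s & forall x, p < x < m -> ~ J x].
  have [[y [Jy ym]]|no] := pselect (exists y, J y /\ y < m); last first.
    by left=> x Jx; rewrite leNgt; apply/negP => xm; apply: no; exists x.
  have outL x : J x -> x < m -> x <= z - h.
    move=> Jx xm; rewrite leNgt; apply/negP => hx.
    by have := mmin x (AP x Jx _); lra.
  right; have [|p [Jp /=]] := @compact_has_max _ (J `&` `[y, z - h]) _ (cI _ _).
    by exists y; split=> //=; rewrite in_itv /= lexx outL.
  rewrite in_itv /= => /andP[yp ph] pmax; exists p; split=> //; first exact: isoL.
  move=> x /andP[px xm] Jx; have : x <= p; last by lra.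
  by apply: pmax; split=> //=; rewrite in_itv /= outL // (le_trans yp (ltW px)).
have HR : (forall x, J x -> x <= M) \/
    exists q, [/\ J q, z + h + s < q & forall x, M < x < q -> ~ J x].
  have [[y [Jy ym]]|no] := pselect (exists y, J y /\ M < y); last first.
    by left=> x Jx; rewrite leNgt; apply/negP => xm; apply: no; exists x.
  have outR x : J x -> M < x -> z + h <= x.
    move=> Jx xm; rewrite leNgt; apply/negP => hx.
    by have := Mmax x (AP x Jx _); lra.
  right; have [|q [Jq /=]] := @compact_has_min _ (J `&` `[z + h, y]) _ (cI _ _).
    by exists y; split=> //=; rewrite in_itv /= lexx outR.
  rewrite in_itv /= => /andP[hq qy] qmin; exists q; split=> //; first exact: isoR.
  move=> x /andP[Mx xq] Jx; have : q <= x; last by lra.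
  by apply: qmin; split=> //=; rewrite in_itv /= outR // (le_trans (ltW xq) qy).
have tR q : J q -> z + h + s < q -> (forall x, M < x < q -> ~ J x) ->
    (forall x, m - (q - M) < x < m -> ~ J x) -> False.
  move=> Jq hq noR noL; apply: (thin (q - M) M); first by lra.
  by apply: thickness_at_gap_right => //; lra.
have tL p : J p -> p < z - h - s -> (forall x, p < x < m -> ~ J x) ->
    (forall x, M < x < M + (m - p) -> ~ J x) -> False.
  move=> Jp hp noL noR; apply: (thin (m - p) m); first by lra.
  by apply: thickness_at_gap_left => //; lra.
move=> x Jx; case: HL HR => [minJ|[p [Jp hp noL]]] [maxJ|[q [Jq hq noR]]].
- by rewrite ler_norml; have := minJ _ Jx; have := maxJ _ Jx; lra.
- by case: (tR q) => // y yb /minJ; lra.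
- by case: (tL p) => // y yb /maxJ; lra.
- have [le|le] := leP (q - M) (m - p).
    by case: (tR q) => // y yb; apply: noL; lra.
  by case: (tL p) => // y yb; apply: noR; lra.
Qed.

(** Distances are all multiplied by [|l|], and the bound [2 * h <= r * s] is
    homogeneous. *)
Lemma affine_no_isolated_cluster (R : realType) (r t l : R) (J : set R) :
  l != 0 -> no_isolated_cluster r J ->
  no_isolated_cluster r (affine_image t l J).
Proof.
move=> l0 ncJ z h s s0 hrs [_ [x0 Jx0 <-] x0h] iso _ [x Jx <-].
have nl0 : 0 < `|l| by rewrite normr_gt0.
have dist y : `|t + l * y - z| = `|l| * `|y - (z - t) / l|.
  by rewrite -normrM; congr `|_|; field.
have := ncJ ((z - t) / l) (h / `|l|) (s / `|l|) _ _ _ _ x Jx.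
rewrite dist ler_pdivlMr // [_ * `|l|]mulrC; apply.
- by rewrite divr_gt0.
- by rewrite !mulrA ler_pM2r ?invr_gt0.
- by exists x0 => //; rewrite ler_pdivlMr // mulrC -dist.
- move=> y Jy.
  rewrite -mulrDl ler_pdivlMr // ler_pdivrMr // [_ * `|l|]mulrC -dist.
  by apply: iso; exists y.
Qed.

(** * Central Cantor sets *)

(** Stages are indexed by centre and half-length.  Putting the two recursive
    calls on the two outer balls, instead of refining the previous stage, lets
    every induction below generalize over [z] and [l]. *)
Fixpoint central_stage {R : realType} (rho : R) (k : nat) (z l : R) : set R :=
  if k is k'.+1 then
    central_stage rho k' (z - (1 - rho) * l) (rho * l) `|`
    central_stage rho k' (z + (1 - rho) * l) (rho * l)
  else `[z - l, z + l].

Definition central_cantor {R : realType} (rho z l : R) : set R :=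
  \bigcap_k central_stage rho k z l.

Lemma closed_central_stage (R : realType) (rho : R) k z l :
  closed (central_stage rho k z l).
Proof.
elim: k z l => [|k IH] z l /=; first exact: itv_closed.
exact: closedU.
Qed.

Lemma central_stage_subitv (R : realType) (rho : R) k z l :
  0 <= rho <= 1 -> 0 <= l -> central_stage rho k z l `<=` `[z - l, z + l].
Proof.
move=> rho01; elim: k z l => [|k IH] z l l0 //= x.
have rl0 : 0 <= rho * l by rewrite mulr_ge0 //; case/andP: rho01.
have rl : rho * l <= l by rewrite ler_piMl //; case/andP: rho01.
by case=> /(IH _ _ rl0) /=; rewrite !in_itv /=; lra.
Qed.

Lemma central_stage_decr (R : realType) (rho : R) k z l :
  0 <= rho <= 1 -> 0 <= l ->
  central_stage rho k.+1 z l `<=` central_stage rho k z l.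
Proof.
move=> rho01; elim: k z l => [|k IH] z l l0.
  exact: (@central_stage_subitv _ _ 1).
have rl0 : 0 <= rho * l by rewrite mulr_ge0 //; case/andP: rho01.
by move=> x [] /(IH _ _ rl0); [left|right].
Qed.

Lemma central_stage_measure (R : realType) (rho : R) k z l :
  0 <= rho -> 0 <= l ->
  (lebesgue_measure (central_stage rho k z l) <=
     ((2 * rho) ^+ k * (2 * l))%:E)%E.
Proof.
move=> rho0; elim: k z l => [|k IH] z l l0.
  have -> : lebesgue_measure (central_stage rho 0 z l) = (z + l - (z - l))%:E.
    by apply: interval_length_cc; lra.
  by rewrite lee_fin expr0; lra.
have rl0 : 0 <= rho * l by rewrite mulr_ge0.
apply: le_trans (measureU2 _ _ _) _; try
  by apply: measurable_realfun.closed_measurable; exact: closed_central_stage.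
apply: le_trans (leeD (IH _ _ rl0) (IH _ _ rl0)) _.
by rewrite -EFinD lee_fin exprS; lra.
Qed.

Lemma closed_central_cantor (R : realType) (rho z l : R) :
  closed (central_cantor rho z l).
Proof. by apply: closed_bigI => k _; exact: closed_central_stage. Qed.

Lemma central_cantor_null (R : realType) (rho z l : R) :
  0 <= rho -> 2 * rho < 1 -> 0 <= l ->
  lebesgue_measure (central_cantor rho z l) = 0%E.
Proof.
move=> rho0 rho1 l0; apply/eqP; rewrite eq_le measure_ge0 andbT.
have cvg0 : ((2 * rho) ^+ k * (2 * l))%:E @[k --> \oo] --> (0%:E : \bar R).
  apply: cvg_EFin; first exact: nearW.
  rewrite -[X in _ --> X](mul0r (2 * l)); apply: cvgM; last exact: cvg_cst.
  by apply: cvg_expr; rewrite ger0_norm //; lra.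
apply: (cvge_ge _ cvg0).
apply: nearW => k; apply: le_trans (central_stage_measure k z rho0 l0).
apply: le_measure; rewrite ?inE.
- by apply: measurable_realfun.closed_measurable; exact: closed_central_cantor.
- by apply: measurable_realfun.closed_measurable; exact: closed_central_stage.
- by move=> x /(_ k I).
Qed.

(** The annulus [l - 2 * (rho * l) <= |x - z| <= l] is the union of the two balls
    of the next stage.  If [J] avoided it, then [J] would be contained in the ball
    of radius [l - 2 * (rho * l)], against its diameter. *)
Lemma central_stage_meets (R : realType) (r rho : R) (J : set R) k z l :
  no_isolated_cluster r J -> 0 < rho -> 2 * rho <= 1 -> 1 - 2 * rho <= r * rho ->
  0 < l ->
  (exists x y, [/\ J x, J y & 2 * l < `|x - y|]) ->
  J `&` `[z - l, z + l] !=set0 -> J `&` central_stage rho k z l !=set0.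
Proof.
move=> ncJ rho0 rho1 hrho; elim: k z l => [//|k IH] z l l0 diam [x0 [Jx0 /=]].
rewrite in_itv /= => x0b.
have rl0 : 0 < rho * l by rewrite mulr_gt0.
have rl : 2 * (rho * l) <= l by rewrite mulrA ler_piMl // ltW.
have diam' : exists x y, [/\ J x, J y & 2 * (rho * l) < `|x - y|].
  by have [x [y [Jx Jy xy]]] := diam; exists x, y; split=> //; lra.
have [[x [Jx xb]]|no] := pselect (exists x, J x /\
    (l - 2 * (rho * l) <= `|x - z| <= l)).
  case: (ger0P (x - z)) xb => xz xb.
  - have [|y [Jy Sy]] := IH (z + (1 - rho) * l) (rho * l) rl0 diam'.
      by exists x; split=> //=; rewrite in_itv /=; lra.
    by exists y; split=> //; right.
  - have [|y [Jy Sy]] := IH (z - (1 - rho) * l) (rho * l) rl0 diam'.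
      by exists x; split=> //=; rewrite in_itv /=; lra.
    by exists y; split=> //; left.
have x0l : `|x0 - z| <= l by rewrite ler_norml; lra.
exfalso; have small : forall x, J x -> `|x - z| <= l - 2 * (rho * l).
  apply: (ncJ z (l - 2 * (rho * l)) (2 * (rho * l))); first by lra.
  - have : (1 - 2 * rho) * l <= r * rho * l by rewrite ler_pM2r.
    by lra.
  - exists x0 => //; rewrite leNgt; apply/negP => h.
    by apply: no; exists x0; split=> //; rewrite (ltW h).
  - by move=> x Jx; apply/negP => xb; apply: no; exists x; split=> //; lra.
have [x [y [Jx Jy xy]]] := diam.
have := ler_distD z x y; rewrite [`|z - y|]distrC.
by have := small _ Jx; have := small _ Jy; lra.
Qed.

Lemma compact_meets_nested (R : realType) (J : set R) (S : nat -> set R) :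
  compact J -> (forall k, closed (S k)) -> (forall k, S k.+1 `<=` S k) ->
  (forall k, J `&` S k !=set0) -> J `&` \bigcap_k S k !=set0.
Proof.
move=> cJ clS decS meet; pose x k := projT1 (cid (meet k)).
have Jx k : J (x k) by rewrite /x; case: cid => ? [].
have Sx k : S k (x k) by rewrite /x; case: cid => ? [].
have subS j k : (j <= k)%N -> S k `<=` S j.
  move/subnKC <-; elim: (k - j)%N => [|i IH]; first by rewrite addn0.
  by rewrite addnS; exact: subset_trans (decS _) IH.
have [|p [Jp clp]] := cJ (x @ \oo) _.
  by exists 0%N => // k _; exact: Jx.
exists p; split=> // k _; apply: clS => B Bp; apply: clp => //.
by exists k => // j /= kj; exact: subS kj _ (Sx j).
Qed.

Lemma meets_central_cantor (R : realType) (r rho z l : R) (J : set R) :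
  compact J -> no_isolated_cluster r J ->
  0 < rho -> 2 * rho <= 1 -> 1 - 2 * rho <= r * rho -> 0 < l ->
  (exists x y, [/\ J x, J y & 2 * l < `|x - y|]) ->
  J `&` `[z - l, z + l] !=set0 -> J `&` central_cantor rho z l !=set0.
Proof.
move=> cJ ncJ rho0 rho1 hrho l0 diam meet; apply: compact_meets_nested => // k.
- exact: closed_central_stage.
- by apply: central_stage_decr; lra.
- exact: central_stage_meets ncJ _ _ _ _ _ _.
Qed.

(** * Avoiding thick Cantor sets *)

Lemma conull_dense (R : realType) (G : set R) :
  lebesgue_measure (~` G) = 0%E -> measurable G -> dense G.
Proof.
move=> G0 mG O [x Ox] oO; apply: contrapT => OG.
have [e /= e0 sO] : nbhs_ball x O by apply/nbhs_ballP; exact: open_nbhs_nbhs.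
have : (lebesgue_measure (ball x e) <= lebesgue_measure (~` G))%E.
  apply: le_measure; rewrite ?inE.
  - exact: measurable_realfun.measurable_ball.
  - exact: measurableC.
  - by move=> y xy Gy; apply: OG; exists y; split=> //; exact: sO.
rewrite G0 lebesgue_measure_ball; last exact: ltW.
by rewrite lee_fin; lra.
Qed.

Theorem theorem1p5 (R : realType) :
  (exists G : set R,
     [/\ dense G, Gdelta G, lebesgue_measure (~` G) = 0%E &
         forall J : set R, cantor_subset J -> (0 < newhouse_thickness J)%E ->
           ~ contains_affine_copy G J]) /\
  (forall J : set R, cantor_subset J -> (0 < newhouse_thickness J)%E ->
     ~ generically_universal J).
Proof.
suff [G [dG GG G0 GJ]] : exists G : set R,
     [/\ dense G, Gdelta G, lebesgue_measure (~` G) = 0%E &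
         forall J : set R, cantor_subset J -> (0 < newhouse_thickness J)%E ->
           ~ contains_affine_copy G J].
  split; first by exists G.
  by move=> J cJ tJ /(_ G dG GG G0); exact: GJ.
pose e (n : nat) : R := n.+2%:R^-1.
(* The parameter [e n] serves both as the radius and as the removed fraction,
   since both have to be small. *)
pose F (i : nat) : set R :=
  if unpickle i is Some (n, q)
  then central_cantor ((1 - e n) / 2) (ratr (q : rat)) (e n) else set0.
have e0 n : 0 < e n by rewrite invr_gt0.
have e1 n : e n <= 1 / 2.
  by rewrite div1r lef_pV2 ?posrE // ler_nat.
have Fcl i : closed (F i).
  rewrite /F; case: (unpickle i) => [[n q]|]; last exact: closed0.
  exact: closed_central_cantor.
have Fnull i : lebesgue_measure (F i) = 0%E.
  rewrite /F; case: (unpickle i) => [[n q]|]; last exact: measure0.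
  by apply: central_cantor_null; have := e0 n; have := e1 n; lra.
pose G := \bigcap_i ~` F i.
have GG : Gdelta G by exists (fun i => ~` F i) => // i; exact: closed_openC.
have mG : measurable G by exact: Gdelta_measurable.
have G0 : lebesgue_measure (~` G) = 0%E.
  apply: measure_negligible; first exact: measurableC.
  rewrite setC_bigcap; apply: negligible_bigcup => i; rewrite setCK.
  exists (F i); split; [|exact: Fnull|by []].
  exact: measurable_realfun.closed_measurable (Fcl i).
exists G; split=> //; first exact: conull_dense.
move=> J [[p Jp] _ [_ pJ] cJ] tJ [t [l [l0 sub]]].
have [q [qp Jq _]] : exists q, [/\ q != p, J q & setT q].
  by move: Jp; rewrite -{1}pJ => /(_ setT); apply; exact: filterT.
have [r r01 rJ] : exists2 r : R, 0 < r <= 1 & (r%:E < newhouse_thickness J)%E.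
  case: (newhouse_thickness J) tJ => [x||//].
  - rewrite lte_fin => x0; exists (Num.min (x / 2) 1).
      by rewrite lt_min ge_min lexx orbT andbT; lra.
    by rewrite lte_fin gt_min; lra.
  - by move=> _; exists 1; rewrite ?ltry // ltr01 lexx.
(* The bound [r / 4] makes the removed fraction small against [r]; the bound
   [D / 2] makes the ball small against the diameter [D] of two image points. *)
pose D := `|l| * `|q - p|.
have D0 : 0 < D by rewrite mulr_gt0 // normr_gt0 // subr_eq0.
have [n en] : exists n, e n < Num.min (r / 4) (D / 2).
  have c0 : 0 < Num.min (r / 4) (D / 2) by rewrite lt_min; lra.
  have [n _ /(_ n.+1)] := near_infty_natSinv_lt (PosNum c0).
  by move/(_ (leqnSn n)) => /= H; exists n.
move: en; rewrite lt_min => /andP[enr enD].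
have := e0 n; have := e1 n => e1n e0n.
(* A rational centre whose ball contains the image of [p]. *)
have [z zb] := @rat_in_itvoo R (t + l * p - e n) (t + l * p + e n) ltac:(lra).
have cA : compact (affine_image t l J).
  apply: continuous_compact => //; apply: continuous_subspaceT => x.
  by apply: cvgD; [exact: cvg_cst|apply: cvgM; [exact: cvg_cst|exact: cvg_id]].
have nA : no_isolated_cluster r (affine_image t l J).
  apply: affine_no_isolated_cluster => //.
  by apply: thick_no_isolated_cluster => //; lra.
have [||||||y [Ay Cy]] :=
  @meets_central_cantor R r ((1 - e n) / 2) (ratr z) (e n) _ cA nA.
- lra.
- lra.
- have : r * (e n) <= r * (1 / 2) by rewrite ler_pM2l //; lra.
  by lra.
- exact: e0n.
- exists (t + l * q), (t + l * p); split; [by exists q|by exists p|].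
  have -> : t + l * q - (t + l * p) = l * (q - p) by ring.
  by rewrite normrM -/D; lra.
- exists (t + l * p); split; first by exists p.
  by move: zb; rewrite /= !in_itv /=; lra.
by apply: (sub _ Ay (pickle (n, z)) I); rewrite /F pickleK.
Qed.
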